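(* Let $\mathfrak g$ and $V$ be vector spaces, $\mu\in\mathrm{Hom}(\wedge^2\mathfrak g,\mathfrak g)$, $\rho\in\mathrm{Hom}(\mathfrak g\otimes V,V)$ and $T\in\mathrm{Hom}(V,\mathfrak g)$. Then $((\mathfrak g,\mu),(V;\rho),T)$ is a Lie-Leibniz triple if and only if $(s^{-1}(\mu\boxplus\rho),T)$ is a Maurer-Cartan element of the $L_\infty$-algebra $(s^{-1}L'\oplus\mathfrak h,\{l_i\}_{i\ge1})$ described in the context.
   Context: Vector spaces are over a field of characteristic $0$. A Lie-Leibniz triple $((\mathfrak g,\mu),(V;\rho),T)$ consists of a Lie algebra $(\mathfrak g,\mu)$, a representation $\rho$ of it on $V$, and an embedding tensor $T:V\to\mathfrak g$, i.e. a linear map with $\mu(Tu,Tv)=T(\rho(Tu)v)$ for all $u,v\in V$. Balavoine bracket: for a vector space $E$ let $C^n(E,E)=\mathrm{Hom}(\otimes^{n+1}E,E)$, $n\ge0$. For $P\in C^p(E,E)$, $Q\in C^q(E,E)$: $[P,Q]_{\mathsf B}=P\bar\circ Q-(-1)^{pq}Q\bar\circ P$, $P\bar\circ Q=\sum_{k=1}^{p+1}P\circ_kQ$, $$(P\circ_kQ)(x_1,\dots,x_{p+q+1})=\sum_{\sigma\in\mathbb S_{(k-1,q)}}(-1)^{(k-1)q}(-1)^\sigma P\big(x_{\sigma(1)},\dots,x_{\sigma(k-1)},Q(x_{\sigma(k)},\dots,x_{\sigma(k+q-1)},x_{k+q}),x_{k+q+1},\dots,x_{p+q+1}\big),$$ where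 $\mathbb S_{(i,j)}$ is the set of $(i,j)$-shuffles. $(C^\bullet(E,E),[\cdot,\cdot]_{\mathsf B})$ is a graded Lie algebra. Take $E=\mathfrak g\oplus V$. A map $f$ from a tensor product of copies of $\mathfrak g$ and $V$ (in a given order) to $\mathfrak g$ or $V$ is viewed in $C^\bullet(E,E)$ by extending it by zero on all other tensor components. With this convention, $L'=\bigoplus_{n\ge0}\big(\mathrm{Hom}(\wedge^{n+1}\mathfrak g,\mathfrak g)\oplus\mathrm{Hom}(\wedge^n\mathfrak g\otimes V,V)\big)$ is a graded Lie subalgebra of $C^\bullet(E,E)$ ($n$-th summand in degree $n$); $\mathfrak h=\bigoplus_{n\ge0}\mathrm{Hom}(\otimes^{n+1}V,\mathfrak g)$ is an abelian graded Lie subalgebra ($n$-th summand in degree $n$); $P:C^\bullet(E,E)\to C^\bullet(E,E)$ is the projection onto $\mathfrak h$ keeping only the component $\otimes^{n+1}V\to\mathfrak g$. $s^{-1}$ is the desuspension, $(s^{-1}L')^i=L'^{\,i+1}$. The element $\mu\boxplus\rho\in L'^1$ is $(\mu\boxplus\rho)((x,u),(y,v))=(\mu(x,y),\rho(x)v)$. $L_\infty$-algebra: a graded vector space with degree $1$ graded symmetric maps $l_k$, $k\ge1$, such that $\sum_{i=1}^n\sum_{\sigma\in\mathbb S_{(i,n-i)}}\varepsilon(\sigma)l_{n-i+1}(l_i(x_{\sigma(1)},\dots,x_{\sigma(i)}),x_{\sigma(i+1)},\dots,x_{\sigma(n)})=0$ for all $n\ge1$ ($\varepsilon(\sigma)$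 the Koszul sign). A Maurer-Cartan element is a degree $0$ element $\alpha$ with $\sum_{k\ge1}\frac1{k!}l_k(\alpha,\dots,\alpha)=0$. The $L_\infty$-structure on $s^{-1}L'\oplus\mathfrak h$ is: for homogeneous $Q,Q'\in L'$, $\theta_1,\dots,\theta_{k-1}\in\mathfrak h$, $k\ge2$, $$l_2(s^{-1}Q,s^{-1}Q')=(-1)^{|Q|}s^{-1}[Q,Q']_{\mathsf B},\qquad l_k(s^{-1}Q,\theta_1,\dots,\theta_{k-1})=P[\cdots[[Q,\theta_1]_{\mathsf B},\theta_2]_{\mathsf B},\cdots,\theta_{k-1}]_{\mathsf B},$$ extended by graded symmetry, all other components (in particular $l_1$) being zero. *)

(* Defs.v *)
From HB Require Import structures.
From mathcomp Require Import all_boot all_order all_fingroup all_algebra.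
From mathcomp Require Import functions.
Set Implicit Arguments.
Unset Strict Implicit.
Unset Printing Implicit Defensive.
Import GRing.Theory.
Local Open Scope ring_scope.

Section LieLeibniz.
Variables (K : fieldType) (g V : lmodType K).

Definition alternating2 (mu : g -> g -> g) := forall x, mu x x = 0.

Definition jacobi (mu : g -> g -> g) :=
  forall x y z, mu x (mu y z) + mu y (mu z x) + mu z (mu x y) = 0.

Definition is_lie_algebra (mu : {bilinear g -> g -> g}) :=
  alternating2 mu /\ jacobi mu.

Definition is_representation
    (mu : {bilinear g -> g -> g}) (rho : {bilinear g -> V -> V}) :=
  forall x y v, rho (mu x y) v = rho x (rho y v) - rho y (rho x v).

Definition is_embedding_tensor (mu : {bilinear g -> g -> g})
    (rho : {bilinear g -> V -> V}) (T : {linear V -> g}) :=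
  forall u v, mu (T u) (T v) = T (rho (T u) v).

Definition is_lie_leibniz_triple (mu : {bilinear g -> g -> g})
    (rho : {bilinear g -> V -> V}) (T : {linear V -> g}) :=
  [/\ is_lie_algebra mu, is_representation mu rho
    & is_embedding_tensor mu rho T].

End LieLeibniz.

Section Multilinear.
Variables (K : fieldType) (U W : lmodType K).

(* Only the values of [f] on lists of length [n] matter. *)
Definition multilinear (n : nat) (f : seq U -> W) :=
  forall xs ys a u v, (size xs + size ys).+1 = n ->
    f (xs ++ (a *: u + v) :: ys) = a *: f (xs ++ u :: ys) + f (xs ++ v :: ys).

Definition alternating (n : nat) (f : seq U -> W) :=
  forall xs ys zs u, (size xs + size ys + size zs).+2 = n ->
    f (xs ++ u :: ys ++ u :: zs) = 0.

End Multilinear.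

Definition shuffles (i j : nat) : {set 'S_(i + j)} :=
  [set s : 'S_(i + j) |
    [forall a : 'I_(i + j), forall b : 'I_(i + j),
      (a < b)%N && ((b < i)%N || (i <= a)%N) ==> (s a < s b)%N]].

Section Balavoine.
Variables (K : fieldType) (E : lmodType K).

(* An element of Hom(E^{(x) n+1}, E) is encoded as the function [seq E -> E]
   giving its values on lists of length n+1, extended by 0 to lists of any other
   length. *)
Definition cochain : lmodType K := seq E -> E.

(* P o_k Q for P of degree p and Q of degree q, where j = k - 1; lists are
   indexed from 0, so that x_{k+q} is [nth 0 xs (j + q)]. *)
Definition insertion (p q j : nat) (P Q : cochain) : cochain := fun xs =>
  if size xs == (p + q).+1 then
    \sum_(s in shuffles j q)
      let ys := [seq nth 0 xs (s i) | i <- enum 'I_(j + q)] in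
      ((-1) ^+ (j * q) * (-1) ^+ odd_perm s) *:
        P (take j ys ++ Q (rcons (drop j ys) (nth 0 xs (j + q)))
             :: drop (j + q).+1 xs)
  else 0.

Definition circ (p q : nat) (P Q : cochain) : cochain :=
  \sum_(j < p.+1) insertion p q j P Q.

Definition balavoine (p q : nat) (P Q : cochain) : cochain :=
  circ p q P Q - (-1) ^+ (p * q) *: circ q p Q P.

(* [[..[[Q, t_1], t_2], ..], t_m], for [ts] the list of the pairs
   (degree of t_i, t_i). *)
Fixpoint iter_balavoine (q : nat) (Q : cochain) (ts : seq (nat * cochain)) :
    cochain :=
  if ts is (n, t) :: ts' then
    iter_balavoine (q + n) (balavoine q n Q t) ts'
  else Q.

End Balavoine.

(* The data underlying an L-infinity algebra: a graded space, given by its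
   homogeneous components inside an ambient space, and brackets l_k, k >= 1,
   given on homogeneous elements. The bracket l_k is applied to a list of
   length k of pairs (degree of x_i, x_i). *)
Record brackets (K : fieldType) := Brackets {
  ambient : lmodType K;
  component : int -> ambient -> Prop;
  bracket : seq (int * ambient) -> ambient }.

(* The Maurer-Cartan series has only finitely many nonzero terms when it is
   meaningful; this is part of the definition. *)
Definition maurer_cartan (K : fieldType) (L : brackets K) (x : ambient L) :=
  component 0 x /\
  exists N : nat,
    (forall k, (N <= k)%N -> bracket (nseq k (0, x)) = 0) /\
    \sum_(1 <= k < N) (k`!%:R)^-1 *: bracket (nseq k (0, x)) = 0.

Section Controlling.
Variables (K : fieldType) (g V : lmodType K).

Definition total : lmodType K := (g * V)%type.

(* The extensions by zero of a : g^{(x) n+1} -> g and of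
   b : g^{(x) n} (x) V -> V, added together. *)
Definition ext_L' (n : nat) (a : seq g -> g) (b : seq g -> V -> V) :
    cochain total := fun xs =>
  if size xs == n.+1 then
    (a (map fst xs), b (map fst (take n xs)) (nth 0 xs n).2)
  else 0.

Definition in_L' (n : nat) (Q : cochain total) :=
  exists (a : seq g -> g) (b : seq g -> V -> V),
    [/\ multilinear n.+1 a /\ alternating n.+1 a,
        forall v, multilinear n (b^~ v) /\ alternating n (b^~ v),
        forall xs, size xs = n -> linear (b xs)
      & Q = ext_L' n a b].

Definition ext_h (n : nat) (t : seq V -> g) : cochain total := fun xs =>
  if size xs == n.+1 then (t (map snd xs), 0) else 0.

Definition in_h (n : nat) (theta : cochain total) :=
  exists t : seq V -> g, multilinear n.+1 t /\ theta = ext_h n t.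

Definition proj_h (f : cochain total) : cochain total :=
  fun xs => ((f [seq (0, x.2) | x <- xs]).1, 0).

(* L' and h are concentrated in nonnegative degrees. *)
Definition in_deg (A : nat -> cochain total -> Prop) (i : int)
    (f : cochain total) :=
  match i with Posz n => A n f | Negz _ => f = 0 end.

(* The pair (Q, theta) stands for s^{-1} Q + theta, so that Q has degree
   i + 1 in L' when the pair has degree i. *)
Definition sL'h : lmodType K := (cochain total * cochain total)%type.

Definition sL'h_component (i : int) (x : sL'h) :=
  in_deg in_L' (i + 1) x.1 /\ in_deg in_h i x.2.

(* In the next two definitions, the absolute values turn degrees into natural
   numbers: when the degree is negative, the corresponding element is 0. *)

Definition l2_L' (xs : seq (int * sL'h)) : cochain total :=
  if xs is [:: (d, x); (d', x')] then
    (-1) ^+ `|(d + 1)%R|%N *: balavoine `|(d + 1)%R|%N `|(d' + 1)%R|%N x.1 x'.1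
  else 0.

(* l_k(theta_1, .., theta_j, s^{-1} Q, theta_{j+1}, .., theta_{k-1}), obtained
   by moving s^{-1} Q to the first place, which produces a Koszul sign. *)
Definition lk_mixed (xs : seq (int * sL'h)) (j : nat) : cochain total :=
  let: (d, x) := nth (0, 0) xs j in
  let before := take j xs in
  let others := before ++ drop j.+1 xs in
  (-1) ^+ `|(d * \sum_(y <- before) y.1)%R|%N *:
    proj_h (iter_balavoine `|(d + 1)%R|%N x.1
              [seq (`|y.1|%N, y.2.2) | y <- others]).

(* The expansion of l_k(s^{-1} Q_1 + theta_1, .., s^{-1} Q_k + theta_k). *)
Definition sL'h_bracket (xs : seq (int * sL'h)) : sL'h :=
  if (size xs < 2)%N then 0
  else (l2_L' xs, \sum_(j < size xs) lk_mixed xs j).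

Definition controlling_algebra : brackets K :=
  Brackets sL'h_component sL'h_bracket.

Definition boxplus (mu : g -> g -> g) (rho : g -> V -> V) : cochain total :=
  fun xs => if xs is [:: x; y] then (mu x.1 y.1, rho x.1 y.2) else 0.

Definition cochain_of_linear (T : V -> g) : cochain total :=
  fun xs => if xs is [:: x] then (T x.2, 0) else 0.

End Controlling.

(* Main.v *)
Require Import Defs.
From HB Require Import structures.
From mathcomp Require Import all_boot all_order all_fingroup all_algebra.
From mathcomp Require Import functions.
From mathcomp Require Import boolp.
Import GRing.Theory.
Local Open Scope ring_scope.

(* Write M for mu + rho. On x = (s^-1 M, T) every l_k with k >= 2 has only two
   kinds of contributions: -s^-1 [M, M] when k = 2, and k times
   P [..[M, T].., T]. The equation [M, M] = 0 is the Leibniz identity for M,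
   i.e. the Jacobi identity of mu together with the representation identity of
   rho. Bracketing with T once yields nothing in Hom(V (x) V, g), twice yields
   2 (mu(T u, T v) - T(rho(T u) v)), and three times yields 0. *)

(** * Shuffles with an empty block *)

Lemma increasing_perm_geq {n : nat} (s : 'S_n) (i : 'I_n) :
  (forall a b : 'I_n, (a < b)%N -> (s a < s b)%N) -> (i <= s i)%N.
Proof.
move=> inc; case: i => m; elim: m => [//|m IHm] lt_mn.
apply: leq_ltn_trans (IHm (ltnW lt_mn)) _; exact: inc.
Qed.

(** [increasing_perm_geq], applied to [s] and to its inverse, which is increasing too, bounds [s i]
    from both sides. *)
Lemma increasing_perm_eq1 {n : nat} (s : 'S_n) :
  (forall a b : 'I_n, (a < b)%N -> (s a < s b)%N) -> s = 1%g.
Proof.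
move=> inc; apply/permP=> i; rewrite perm1; apply/val_inj/eqP.
rewrite eqn_leq increasing_perm_geq // andbT.
have incV (a b : 'I_n) : (a < b)%N -> (s^-1%g a < s^-1%g b)%N.
  move=> ltab; rewrite ltnNge leq_eqVlt; apply/norP; split.
    by apply/negP=> /eqP/val_inj/perm_inj eqba; rewrite eqba ltnn in ltab.
  by apply/negP=> /inc; rewrite !permKV ltnNge ltnW.
by have := @increasing_perm_geq _ s^-1%g (s i) incV; rewrite permK.
Qed.

(** With one block empty, the shuffle condition constrains every pair [a < b]. *)
Lemma shuffles_eq1 (i j : nat) : (i * j = 0)%N -> shuffles i j = [set 1%g].
Proof.
move=> ij0; apply/setP=> s; rewrite !inE; apply/idP/eqP => [shs|->].
  apply: increasing_perm_eq1 => a b ltab.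
  have /forallP/(_ b)/implyP := forallP shs a; apply.
  rewrite ltab; move/eqP: ij0; rewrite muln_eq0 => /orP[/eqP i0|/eqP j0].
    by rewrite (@leq_trans 0 i a) ?orbT // i0.
  by rewrite (@leq_trans (i + j) b.+1 i) // j0 addn0.
apply/forallP=> a; apply/forallP=> b; apply/implyP=> /andP[ltab _].
by rewrite !perm1.
Qed.

Lemma map_nth_enum_ord {A : Type} (x0 : A) (xs : seq A) (n : nat) :
  (n <= size xs)%N -> [seq nth x0 xs (i : 'I_n) | i <- enum 'I_n] = take n xs.
Proof.
move=> le_n; rewrite -[RHS](map_nth_iota0 x0) // -val_enum_ord -map_comp.
by [].
Qed.

(** * Insertions and Balavoine brackets in low degree *)

Section Insertion.
Context {K : fieldType} {E : lmodType K}.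
Implicit Types (P Q : cochain E) (xs : seq E).

(** Only the identity shuffle remains and its sign exponent is 0. The one other insertion evaluated
    below has [j = q = 1]. *)
Lemma insertion_trivial_shuffle (p q j : nat) P Q xs :
    (j * q = 0)%N -> (j <= p)%N -> size xs = (p + q).+1 ->
  insertion p q j P Q xs =
    P (take j xs ++ Q (take q.+1 (drop j xs)) :: drop (j + q).+1 xs).
Proof.
move=> jq0 le_jp sz; rewrite /insertion sz eqxx shuffles_eq1 // big_set1.
have lt_jq : (j + q < size xs)%N by rewrite sz ltnS leq_add2r.
under eq_map do rewrite perm1.
rewrite map_nth_enum_ord 1?ltnW // jq0 odd_perm1 mulr1 scale1r.
rewrite take_takel ?leq_addr // (take_nth 0) ?size_drop ?ltn_subRL //.
by rewrite nth_drop take_drop addnC.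
Qed.

Lemma insertion_size (p q j : nat) P Q xs :
  size xs != (p + q).+1 -> insertion p q j P Q xs = 0.
Proof. by rewrite /insertion => /negPf->. Qed.

(** Both permutations of two letters are shuffles; the prefactor [(-1) ^+ (j * q)], here -1, makes
    the identity term negative and the transposition term positive. *)
Lemma insertion111 P Q x y z :
  insertion 1 1 1 P Q [:: x; y; z] =
    P [:: y; Q [:: x; z]] - P [:: x; Q [:: y; z]].
Proof.
pose o0 : 'I_(1 + 1) := ord0; pose o1 : 'I_(1 + 1) := ord_max.
have ordP (a b : 'I_(1 + 1)) : (a < b)%N -> a = o0 /\ b = o1.
  by case: a b => [[|[|a]] ?] [[|[|b]] ?] // _; split; apply: val_inj.
have S2 (s : 'S_(1 + 1)) : s = 1%g \/ s = tperm o0 o1.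
  have [lt01|] := ltnP (s o0) (s o1).
    by left; apply: increasing_perm_eq1 => a b /ordP[-> ->].
  rewrite leq_eqVlt => /orP[/eqP/val_inj/perm_inj //|lt10]; right.
  (* If [s] reverses the order, precomposing with the transposition makes it increasing. *)
  have ts1 : (tperm o0 o1 * s)%g = 1%g.
    apply: increasing_perm_eq1 => a b /ordP[-> ->].
    by rewrite !permM tpermL tpermR.
  by rewrite -[s](mulKg (tperm o0 o1)) ts1 mulg1 tpermV.
have neq : 1%g != tperm o0 o1.
  by apply/eqP=> /permP/(_ o0); rewrite perm1 tpermL.
have shE : shuffles 1 1 = [set 1%g; tperm o0 o1].
  apply/setP=> s; rewrite !inE; apply/idP/idP.
    by case: (S2 s) => ->; rewrite eqxx ?orbT.
  move=> _; apply/forallP=> a; apply/forallP=> b; apply/implyP.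
  by case/andP=> /ordP[-> ->].
rewrite /insertion /= shE big_setU1 ?inE //= big_set1.
have enumE : enum 'I_(1 + 1) = [:: o0; o1].
  by apply: (inj_map val_inj); rewrite val_enum_ord.
rewrite enumE /= !perm1 tpermL tpermR odd_perm1 odd_tperm /=.
by rewrite mulr1 expr1 mulrNN mulr1 scale1r scaleN1r addrC.
Qed.

Lemma circE (p q : nat) P Q xs :
  circ p q P Q xs = \sum_(j < p.+1) insertion p q j P Q xs.
Proof. by rewrite /circ fct_sumE. Qed.

Lemma balavoine_size (p q : nat) P Q xs :
  size xs != (p + q).+1 -> balavoine p q P Q xs = 0.
Proof.
move=> sz; have sz' : size xs != (q + p).+1 by rewrite addnC.
(* Operations on cochains are pointwise by definition, so this form is convertible to the goal. *)
suff: circ p q P Q xs - (-1) ^+ (p * q) *: circ q p Q P xs = 0 by [].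
by rewrite !circE !big1 ?scaler0 ?subr0 // => j _; apply: insertion_size.
Qed.

Lemma balavoine10E P Q x y :
  balavoine 1 0 P Q [:: x; y] =
    P [:: Q [:: x]; y] + P [:: x; Q [:: y]] - Q [:: P [:: x; y]].
Proof.
transitivity (circ 1 0 P Q [:: x; y]
              - (-1) ^+ (1 * 0) *: circ 0 1 Q P [:: x; y]) => //.
rewrite !circE !big_ord_recl !big_ord0 !addr0 muln0 expr0 scale1r.
by rewrite !insertion_trivial_shuffle.
Qed.

(** Cochains are arbitrary functions on lists, so the vanishing of [Q] at a zero entry has to be
    assumed. *)
Lemma balavoine0 (p q : nat) Q :
  (forall xs ys, Q (xs ++ 0 :: ys) = 0) -> balavoine p q 0 Q = 0.
Proof.
move=> Q0; apply/funext=> xs.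
suff: circ p q 0 Q xs - (-1) ^+ (p * q) *: circ q p Q 0 xs = 0 by [].
rewrite !circE !big1 ?scaler0 ?subr0 // => j _;
  rewrite /insertion; case: ifP => // _; apply: big1 => s _.
  by rewrite Q0 scaler0.
exact: scaler0.
Qed.

(** In degree 1 the graded commutator is a sum, giving twice [circ 1 1 P P], which is the Leibniz
    defect of [P]. *)
Lemma balavoine11E P x y z :
  balavoine 1 1 P P [:: x; y; z] =
    (P [:: P [:: x; y]; z] + P [:: y; P [:: x; z]]
     - P [:: x; P [:: y; z]]) *+ 2.
Proof.
transitivity (circ 1 1 P P [:: x; y; z]
              - (-1) ^+ (1 * 1) *: circ 1 1 P P [:: x; y; z]) => //.
rewrite muln1 expr1 scaleN1r opprK -mulr2n circE !big_ord_recl big_ord0 addr0.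
by rewrite insertion_trivial_shuffle // insertion111 /= addrA.
Qed.

End Insertion.

(** Serves to compare two truncations of a terminating series at a common bound. *)
Lemma big_nat_widen0 {W : zmodType} (F : nat -> W) (m n n' : nat) :
    (n <= n')%N -> (forall k, (n <= k)%N -> F k = 0) ->
  \sum_(m <= k < n) F k = \sum_(m <= k < n') F k.
Proof.
move=> le_nn' F0; rewrite (big_nat_widen _ _ _ _ _ le_nn') big_mkcond.
by apply: eq_bigr => k _ /=; case: ltnP => // /F0 ->.
Qed.

(** * The brackets at a degree 0 element and the Maurer-Cartan equation *)

Section ControllingAlgebra.
Context {K : fieldType} {g V : lmodType K}.

Lemma proj_h_balavoine_eq0 (p q : nat) (P Q : cochain (Defs.total g V)) :
    (p + q = 1)%N ->
  proj_h (balavoine p q P Q) = 0 <->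
  forall u v, (balavoine p q P Q [:: (0, u); (0, v)]).1 = 0.
Proof.
move=> pq1; split=> [B0 u v|B0].
  by have := congr1 (fun f => (f [:: (0, u); (0, v)]).1) B0.
apply/funext=> xs; rewrite /proj_h.
have [sz|sz] := eqVneq (size xs) 2; last first.
  by rewrite balavoine_size ?size_map ?pq1.
by case: xs sz => [|x[|y[|? ?]]] // _; rewrite B0.
Qed.

(** All entries have degree 0, so no Koszul sign arises; undoing the desuspension gives [x.1] degree
    1. *)
Lemma lk_mixed_nseq (x : sL'h g V) (k j : nat) : (j <= k)%N ->
  lk_mixed (nseq k.+1 (0, x)) j =
    proj_h (iter_balavoine 1 x.1 (nseq k (0%N, x.2))).
Proof.
move=> le_jk; rewrite /lk_mixed nth_nseq ltnS le_jk mul0r expr0 scale1r.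
by rewrite take_nseq 1?leqW // drop_nseq subSS -nseqD subnKC // map_nseq.
Qed.

Lemma sL'h_bracket_nseq (x : sL'h g V) (k : nat) :
  sL'h_bracket (nseq k.+2 (0, x)) =
    (if k is 0 then - balavoine 1 1 x.1 x.1 else 0,
     proj_h (iter_balavoine 1 x.1 (nseq k.+1 (0%N, x.2))) *+ k.+2).
Proof.
rewrite /sL'h_bracket size_nseq; congr pair.
  by case: k => [|[|k]] //=; rewrite expr1 scaleN1r.
rewrite (eq_bigr (fun=> proj_h (iter_balavoine 1 x.1 (nseq k.+1 (0%N, x.2))))).
  by rewrite sumr_const card_ord.
by move=> j _; rewrite lk_mixed_nseq // -ltnS.
Qed.

Context (mu : {bilinear g -> g -> g}) (rho : {bilinear g -> V -> V}).
Context (T : {linear V -> g}).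
Let M : cochain (Defs.total g V) := boxplus mu rho.
Let t : cochain (Defs.total g V) := cochain_of_linear T.
Let D := balavoine 1 0 M t.

(** Alternation of [mu] is the hypothesis [mu_alt]; that of [rho] is vacuous, since it has a single
    argument in [g]. *)
Lemma boxplus_in_L' : alternating2 mu -> in_L' 1 M.
Proof.
move=> mu_alt.
exists (fun s => mu s`_0 s`_1), (fun s => rho s`_0).
split=> [|v|[|x[|? ?]] // _ c u v|].
- split=> [xs ys c u v|xs ys zs u].
    by case: xs ys => [|x [|? ?]] [|y [|? ?]] //= _;
      rewrite ?linearPl ?linearPr.
  by case: xs ys zs => [|? ?] [|? ?] [|? ?].
- split=> [[|? ?] [|? ?] c u w // _|xs ys zs u].
    by rewrite /= linearPl.
  by [].
- by rewrite linearPr.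
- by apply/funext=> -[|x[|y[|? ?]]].
Qed.

Lemma cochain_of_linear_in_h : in_h 0 t.
Proof.
exists (fun s => T s`_0); split=> [[|? ?] [|? ?] c u v // _|].
  by rewrite /= linearP.
by apply/funext=> -[|x[|? ?]].
Qed.

Lemma ad_boxplus x y :
  D [:: x; y] = (mu (T x.2) y.1 + mu x.1 (T y.2) - T (rho x.1 y.2),
                 rho (T x.2) y.2).
Proof.
rewrite /D balavoine10E /= (linear0r rho).
by apply: injective_projections => //=; rewrite oppr0 !addr0.
Qed.

(** The factor 2: [mu (T u) (T v)] comes from [T] in either slot of [D], and [T (rho (T u) v)] once
    from [T] in the first slot and once from [T] applied to the output of [D]. *)
Lemma ad2_boxplus x y :
  balavoine 1 0 D t [:: x; y] =
    ((mu (T x.2) (T y.2) - T (rho (T x.2) y.2)) *+ 2, 0).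
Proof.
rewrite balavoine10E !ad_boxplus /= (linear0 T) (linear0l mu) (linear0l rho)
  (linear0r mu) !(linear0r rho).
apply: injective_projections => /=; last by rewrite oppr0 !addr0.
by rewrite linear0 add0r subr0 addr0 mulr2n addrA.
Qed.

(* [-, T] raises by one the number of inputs in V minus the number of outputs
   in V; this number is 0 for M, and at most 2 for a map with two inputs. *)
Lemma ad3_boxplus : balavoine 1 0 (balavoine 1 0 D t) t = 0.
Proof.
apply/funext=> -[|x[|y[|z s]]]; try exact: balavoine_size.
rewrite balavoine10E !ad2_boxplus /= (linear0 T) (linear0l mu) (linear0l rho)
  (linear0r mu) (linear0r rho) !(linear0 T).
by rewrite !subr0 !mul0rn addr0.
Qed.

(** The third bracket is 0, and later ones stay 0 because [T 0 = 0]. *)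
Lemma iter_ad_boxplus (m : nat) :
  iter_balavoine 1 M (nseq m.+3 (0%N, t)) = 0.
Proof.
rewrite /= -/D ad3_boxplus; elim: m => //= m IHm.
by rewrite balavoine0 // => -[|x [|? ?]] [|? ?] //=; rewrite linear0.
Qed.

Lemma maurer_cartanP : alternating2 mu ->
  maurer_cartan (L := controlling_algebra g V) (M, t) <->
  (2%:R)^-1 *: - balavoine 1 1 M M = 0 /\
  (6%:R)^-1 *: (proj_h (balavoine 1 0 D t) *+ 3) = 0.
Proof.
move=> mu_alt.
pose b k : sL'h g V := (k`!%:R)^-1 *: sL'h_bracket (nseq k (0, (M, t))).
have proj0 (W : cochain (Defs.total g V)) : (forall x, W x = 0) -> proj_h W = 0.
  by move=> W0; apply/funext=> xs; rewrite /proj_h W0.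
(* [l_k] brackets [M] with [T] exactly k - 1 times, hence at least three times here. *)
have br4 k : (4 <= k)%N -> sL'h_bracket (nseq k (0, (M, t))) = 0.
  case: k => [|[|[|[|k]]]] // _.
  by rewrite sL'h_bracket_nseq iter_ad_boxplus proj0 // mul0rn.
have b4 k : (4 <= k)%N -> b k = 0.
  by move=> /br4 brk; rewrite /b brk scaler0.
have sum4 : \sum_(1 <= k < 4) b k =
    ((2%:R)^-1 *: - balavoine 1 1 M M,
     (6%:R)^-1 *: (proj_h (balavoine 1 0 D t) *+ 3)).
  do 3![rewrite big_nat_recl //]; rewrite big_geq // addr0 /b.
  rewrite [sL'h_bracket (nseq 1 _)]/(0 : sL'h g V) scaler0 add0r.
  rewrite !sL'h_bracket_nseq /=.
  rewrite (_ : proj_h (balavoine 1 0 M t) = 0); last first.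
    apply/proj_h_balavoine_eq0=> // u v; rewrite -/D ad_boxplus /=.
    by rewrite (linear0l rho) (linear0l mu) (linear0r mu) (linear0 T) addr0
      subr0.
  by rewrite mul0rn; congr pair => /=; rewrite scaler0 (addr0, add0r).
split=> [[_ [N [brN sumN]]]|[e1 e2]].
  have bN k : (N <= k)%N -> b k = 0.
    by move=> /brN /= brk; rewrite /b brk scaler0.
  have : \sum_(1 <= k < 4) b k = 0.
    (* The given bound [N] may lie on either side of 4, so both sums are extended to [4 + N]. *)
    rewrite (big_nat_widen0 b 1 4 (4 + N) (leq_addr _ _) b4).
    by rewrite -(big_nat_widen0 b 1 N (4 + N) (leq_addl _ _) bN); exact: sumN.
  by rewrite sum4 => -[].
split; first by split; [exact: boxplus_in_L' | exact: cochain_of_linear_in_h].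
exists 4; split; first exact: br4.
by rewrite -/(\sum_(1 <= k < 4) b k) sum4 e1 e2.
Qed.

(** The [g] component is the Jacobi identity rewritten by antisymmetry; the [V] component involves
    only [x.1], [y.1] and [z.2], and is the representation identity. *)
Lemma leibniz_boxplusP : alternating2 mu ->
  (forall x y z, M [:: M [:: x; y]; z] + M [:: y; M [:: x; z]]
                 - M [:: x; M [:: y; z]] = 0) <->
  jacobi mu /\ is_representation mu rho.
Proof.
move=> mu_alt.
have mu_anti x y : mu x y = - mu y x.
  apply/eqP; rewrite -addr_eq0; apply/eqP.
  by have := mu_alt (x + y); rewrite linearDl !linearDr !mu_alt add0r addr0.
have jacE x y z :
    mu x (mu y z) + mu y (mu z x) + mu z (mu x y) =
    - (mu (mu x y) z + mu y (mu x z) - mu x (mu y z)).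
  rewrite (mu_anti z x) linearNr (mu_anti z (mu x y)) !opprD opprK.
  by rewrite -addrA addrC [- mu y _ - _]addrC.
split=> [leib|[jac rep] x y z].
  split=> [x y z|x y v].
    have /(congr1 fst) /= := leib (x, 0) (y, 0) (z, 0).
    by rewrite jacE => ->; rewrite oppr0.
  have /(congr1 snd) /= /eqP := leib (x, 0) (y, 0) (0, v).
  by rewrite subr_eq0 eq_sym -subr_eq => /eqP <-.
apply: injective_projections => /=; last by rewrite rep subrK subrr.
by apply/oppr_inj; rewrite -jacE jac oppr0.
Qed.

End ControllingAlgebra.

(** Cancels the multiplicities 2 and 3 produced by the brackets. *)
Lemma natmul_eq0_pchar0 {K : fieldType} {W : lmodType K} (w : W) (n : nat) :
  [pchar K] =i pred0 -> (w *+ n.+1 == 0) = (w == 0).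
Proof.
by move=> /pcharf0P K0; rewrite -scaler_nat scaler_eq0 K0.
Qed.

Theorem theorem4p9 (K : fieldType) (charK0 : [pchar K] =i pred0)
  (g V : lmodType K) (mu : {bilinear g -> g -> g}) (mu_alt : alternating2 mu)
  (rho : {bilinear g -> V -> V}) (T : {linear V -> g}) :
  is_lie_leibniz_triple mu rho T <->
  @maurer_cartan K (controlling_algebra g V)
    (boxplus mu rho, cochain_of_linear T).
Proof.
have natK0 n : (n%:R == 0 :> K) = (n == 0)%N by apply/pcharf0P: n.
have embE : (6%:R)^-1 *: (proj_h (balavoine 1 0 (balavoine 1 0 (boxplus mu rho)
      (cochain_of_linear T)) (cochain_of_linear T)) *+ 3) = 0 <->
    is_embedding_tensor mu rho T.
  split=> [/eqP|emb].
    rewrite scaler_eq0 invr_eq0 natK0 natmul_eq0_pchar0 //=.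
    move=> /eqP/(proj_h_balavoine_eq0 1 0 _ _ erefl) embT u v; apply/eqP.
    (* The argument 1 stands for the multiplicity 2 of [ad2_boxplus]. *)
    rewrite -subr_eq0 -(@natmul_eq0_pchar0 K _ _ 1) //; apply/eqP.
    by have := embT u v; rewrite ad2_boxplus.
  rewrite (_ : proj_h _ = 0) ?mul0rn ?scaler0 //.
  apply/proj_h_balavoine_eq0=> // u v.
  by rewrite ad2_boxplus /= emb subrr mul0rn.
have leibE : (2%:R)^-1 *: - balavoine 1 1 (boxplus mu rho) (boxplus mu rho) = 0
    <-> jacobi mu /\ is_representation mu rho.
  rewrite -leibniz_boxplusP //; split=> [/eqP|leib].
    rewrite scaler_eq0 invr_eq0 natK0 /= oppr_eq0 => /eqP B0 x y z.
    have /esym/eqP := balavoine11E (boxplus mu rho) x y z.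
    by rewrite B0 natmul_eq0_pchar0 // => /eqP.
  rewrite (_ : balavoine _ _ _ _ = 0) ?oppr0 ?scaler0 //.
  apply/funext=> -[|x[|y[|z[|w s]]]]; try exact: balavoine_size.
  by rewrite balavoine11E leib mul0rn.
rewrite maurer_cartanP // embE leibE.
by split=> [[[_ jac] rep emb]|[[jac rep] emb]].
Qed.
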